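(* Let $X$ and $Y$ be real valued random variables such that $\mathbb{E}\max\{0,Y\}<\infty$ and such that for all $\varphi\in E^*$, $\mathbb{E}\varphi(X)\leq\mathbb{E}\varphi(Y)$, where $E^*$ is the collection of all functions $\varphi_{t,a}:\mathbb{R}\to\mathbb{R}$ of the form $\varphi_{t,a}(x)=\max\{0,a(x-t)+1\}$ with $t\in\mathbb{R}$ and $a\in(0,\infty)$. Let $s\in\mathbb{R}$. I. If $\mathbb{P}\{Y>s\}=0$ then $\mathbb{P}\{X>s\}=0$. II. If $\mathbb{P}\{Y>s\}\neq 0$ then $\mathbb{P}\left\{X\geq \mathbb{E}(Y:Y>s)\right\}\leq\mathbb{P}\{Y>s\}$.
   Context: For an event $A$ with $\mathbb{P}(A)\neq 0$, $\mathbb{E}(Y:A)$ denotes the conditional expectation of $Y$ given the event $A$, i.e. $\mathbb{E}(Y:Y>s)=\mathbb{E}\left[Y1_{(s,\infty)}(Y)\right]/\mathbb{P}\{Y>s\}$. $X$ and $Y$ need not be defined on the same probability space. *)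

(* Defs.v *)
From mathcomp Require Import all_boot all_order all_algebra.
From mathcomp Require Import boolp classical_sets functions reals ereal.
From mathcomp Require Import measure measurable_realfun lebesgue_measure numfun.
From mathcomp Require Import lebesgue_integral probability.

Set Implicit Arguments.
Unset Strict Implicit.
Unset Printing Implicit Defensive.

Import Order.TTheory GRing.Theory Num.Theory.

Local Open Scope classical_set_scope.
Local Open Scope ring_scope.

Definition ramp (R : realType) (t a : R) : R -> R :=
  fun x => Num.max 0 (a * (x - t) + 1).

Definition Estar (R : realType) : set (R -> R) :=
  [set phi | exists t a : R, 0 < a /\ phi = ramp t a].

Arguments Estar : clear implicits.

(* Elementary conditional expectation given an event of nonzero probability;
   junk when [P A = 0] (the library sets 0^-1 = +oo in [\bar R]). *)
Definition cond_expectation (d : measure_display) (T : measurableType d)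
    (R : realType) (P : probability T R) (Y : T -> R) (A : set T) : \bar R :=
  ('E_P[(fun w => (Y w * \1_A w)%R)] / P A)%E.

(* Main.v *)
(** Write [Y_s = max 0 (Y - s)].  The hypothesis applied to [ramp (s + 1) 1],
    which is [x |-> max 0 (x - s)], says [E X_s <= E Y_s].  If [P(Y > s) = 0],
    then [E Y_s = 0], hence [E X_s = 0] and [P(X > s) = 0].  Otherwise, with
    [c = E(Y : Y > s) > s], one has [E Y_s = (c - s) P(Y > s)], and Markov's
    inequality [(c - s) P(X >= c) <= E X_s] concludes. *)
Require Import Defs.
From mathcomp Require Import all_boot all_order all_algebra.
From mathcomp Require Import boolp classical_sets functions reals ereal.
From mathcomp Require Import measure measurable_realfun lebesgue_measure numfun.
From mathcomp Require Import lebesgue_integral probability.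
From mathcomp Require Import lra.

Import Order.TTheory GRing.Theory Num.Theory.

Local Open Scope classical_set_scope.
Local Open Scope ring_scope.

Lemma ramp_excess (R : realType) (s x : R) :
  ramp (s + 1) 1 x = Num.max 0 (x - s).
Proof. by rewrite /ramp; congr Num.max; lra. Qed.

Section Excess.
Context {R : realType} {d : measure_display} {T : measurableType d}.
Context {P : probability T R} (X : {RV P >-> R}).
Implicit Types s c : R.

Let excess s : T -> R := fun w => Num.max 0 (X w - s).

Lemma measurable_excess s : measurable_fun setT (excess s).
Proof.
apply: measurable_maxr; first exact: measurable_cst.
by apply: measurable_funB; [exact: measurable_funPT|exact: measurable_cst].
Qed.

Lemma excess_ge0 s w : 0 <= excess s w.
Proof. by rewrite le_max lexx. Qed.

Lemma measurable_upper_tail s : measurable [set w | s < X w].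
Proof.
have -> : [set w | s < X w] = X @^-1` `]s, +oo[.
  by apply/seteqP; split => w /=; rewrite in_itv/= andbT.
exact: measurable_funPTI.
Qed.

(** A nonnegative measurable function has zero integral exactly when it vanishes almost everywhere,
    and [excess s] is nonzero precisely on the event [s < X]. No integrability of [X] is
    required. *)
Lemma expectation_excess_eq0 s :
  ('E_P[excess s] = 0 <-> P [set w | (s < X w)%R] = 0)%E.
Proof.
have mE : measurable_fun setT (EFin \o excess s).
  by apply/measurable_EFinP; exact: measurable_excess.
have := ae_eq_integral_abs P measurableT mE.
have -> : (\int[P]_w `|(EFin \o excess s) w| = 'E_P[excess s])%E.
  rewrite unlock; apply: eq_integral => w _ /=.
  by rewrite ger0_norm// excess_ge0.
(* Almost everywhere equality unfolds to negligibility of the complement of the zero set; that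
   complement is the tail event. *)
have negE : ae_eq P setT (EFin \o excess s) (cst 0%E) <->
    P.-negligible [set w | s < X w].
  suff -> : [set w | s < X w] =
    ~` [set w | setT w -> (EFin \o excess s) w = cst 0%E w] by [].
  apply/seteqP; split => w /=.
    by move=> sX /(_ I) [] /max_idPl; lra.
  move=> nE; rewrite ltNge; apply/negP => Xs; apply: nE => _; congr EFin.
  by apply/max_idPl; lra.
move=> ->; rewrite negE; split => [|P0].
  by move/measure_negligible; apply; exact: measurable_upper_tail.
by apply/negligibleP => //; exact: measurable_upper_tail.
Qed.

(** Integrate the pointwise bound of [excess s] from below by [c - s] times the indicator of
    [c <= X]. *)
Lemma markov_excess s c : s < c ->
  ((c - s)%:E * P [set w | (c <= X w)%R] <= 'E_P[excess s])%E.
Proof.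
move=> sc.
have mA : measurable [set w | c <= X w].
  have -> : [set w | c <= X w] = X @^-1` `[c, +oo[.
    by apply/seteqP; split => w /=; rewrite in_itv/= andbT.
  exact: measurable_funPTI.
have cs0 : 0 <= c - s by lra.
have -> : ((c - s)%:E * P [set w | (c <= X w)%R] =
    'E_P[fun w => ((c - s) * \1_[set w | c <= X w] w)%R])%E.
  rewrite unlock; under eq_integral do rewrite EFinM.
  rewrite ge0_integralZl//.
    by rewrite integral_indic// setIT.
  by apply/measurable_EFinP; exact: measurable_indic.
apply: expectation_le => //.
- by apply: measurable_funM; [exact: measurable_cst|exact: measurable_indic].
- exact: measurable_excess.
- by move=> w; exact: mulr_ge0.
- exact: excess_ge0.
apply: aeW => w /=; rewrite indicE.
case: (boolP (w \in _)) => [/set_mem/= cX|_].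
  by rewrite mulr1 le_max; apply/orP; right; lra.
by rewrite mulr0 excess_ge0.
Qed.

(** The dominating function is [excess 0 + |s|]: on the event [s < X], a negative value of [X] lies
    between [s] and 0, so its absolute value is at most [|s|], while a nonnegative value equals
    [excess 0]. *)
Lemma integrable_tail s : ('E_P[excess 0] < +oo)%E ->
  P.-integrable setT (fun w => (X w * \1_[set w | s < X w] w)%:E).
Proof.
move=> fin.
have i0 : P.-integrable setT (EFin \o excess 0).
  apply/integrableP; split.
    by apply/measurable_EFinP; exact: measurable_excess.
  move: fin; rewrite unlock; congr (_ < _)%E; apply: eq_integral => w _ /=.
  by rewrite ger0_norm// excess_ge0.
have ic : P.-integrable setT (EFin \o cst `|s|).
  exact: finite_measure_integrable_cst.
apply: (le_integrable measurableT _ _ (integrableD measurableT i0 ic)).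
  apply/measurable_EFinP; apply: measurable_funM; first exact: measurable_funPT.
  by apply: measurable_indic; exact: measurable_upper_tail.
move=> w _; rewrite -EFinD !abse_EFin lee_fin indicE.
rewrite [leRHS]ger0_norm ?addr_ge0 ?excess_ge0//=.
have := excess_ge0 0 w; have := normr_ge0 s; have := ler_norm (- s).
rewrite normrN => H1 H2 H3.
case: (boolP (w \in _)) => [/set_mem/= sX|_]; last first.
  by rewrite mulr0 normr0; lra.
have : X w <= excess 0 w by rewrite le_max subr0 lexx orbT.
by rewrite mulr1 ler_norml; move=> ?; lra.
Qed.

(** Pointwise, the excess is [X - s] times the indicator of the tail; integrability of the truncated
    [X] allows the integral of the difference to be split. *)
Lemma expectation_excess s : ('E_P[excess 0] < +oo)%E ->
  ('E_P[excess s] = 'E_P[fun w => (X w * \1_[set w | (s < X w)%R] w)%R] -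
     s%:E * P [set w | (s < X w)%R])%E.
Proof.
move=> /(integrable_tail s) iX.
have mB := measurable_upper_tail s.
have i1 := integrable_indic P mB.
rewrite unlock.
have -> : P [set w | s < X w] = (\int[P]_w (\1_[set w | s < X w] w)%:E)%E.
  by rewrite integral_indic// setIT.
rewrite -integralZl// -integralB//; last exact: integrableZl.
apply: eq_integral => w _; rewrite -EFinM -EFinB indicE; congr EFin.
rewrite /excess; case: (boolP (w \in _)) => [/set_mem/= sX|].
  by rewrite !mulr1; apply/max_idPr; lra.
rewrite notin_setE/= => /negP; rewrite -leNgt => Xs.
by rewrite !mulr0 subr0; apply/max_idPl; lra.
Qed.

End Excess.

Theorem proposition2 (R : realType)
  (d1 : measure_display) (T1 : measurableType d1) (P : probability T1 R)
  (d2 : measure_display) (T2 : measurableType d2) (Q : probability T2 R)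
  (X : {RV P >-> R}) (Y : {RV Q >-> R})
  (hY : ('E_Q[(fun w => Num.max 0%R (Y w))] < +oo)%E)
  (hXY : forall phi : R -> R, Estar R phi ->
     ('E_P[(phi \o X)] <= 'E_Q[(phi \o Y)])%E)
  (s : R) :
  (Q [set w | (s < Y w)%R] = 0%E -> P [set w | (s < X w)%R] = 0%E)
  /\
  (Q [set w | (s < Y w)%R] <> 0%E ->
   (P [set w | cond_expectation Q Y [set w' | (s < Y w')%R] <= (X w)%:E]
     <= Q [set w | (s < Y w)%R])%E).
Proof.
have leXY : ('E_P[fun w => Num.max 0%R (X w - s)%R] <=
    'E_Q[fun w => Num.max 0%R (Y w - s)%R])%E.
  have := hXY (ramp (s + 1) 1) _.
  have /funext rampE := ramp_excess R s; rewrite rampE; apply.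
  by exists (s + 1), 1; rewrite ltr01 rampE.
split=> [/expectation_excess_eq0 Y0|/eqP Qn0].
  apply/expectation_excess_eq0/eqP; rewrite eq_le -{1}Y0 leXY/=.
  by apply: expectation_ge0 => w; rewrite le_max lexx.
have fin0 : ('E_Q[fun w => Num.max 0%R (Y w - 0)%R] < +oo)%E.
  by under eq_fun do rewrite subr0.
set B := [set w | (s < Y w)%R] in Qn0 *.
have QB : Q B = (fine (Q B))%:E.
  by rewrite fineK// fin_num_measure//; exact: measurable_upper_tail.
set p := fine (Q B) in QB.
have p0 : 0 < p by rewrite -lte_fin -QB lt0e Qn0 measure_ge0.
set eYB := ('E_Q[fun w => (Y w * \1_B w)%R])%E.
have mYB : eYB = (fine eYB)%:E.
  rewrite fineK// /eYB unlock.
  exact: (integrable_fin_num measurableT (integrable_tail Y s fin0)).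
set m := fine eYB in mYB.
have EY : ('E_Q[fun w => Num.max 0%R (Y w - s)%R] = (m - s * p)%:E)%E.
  by rewrite (expectation_excess Y s fin0) -/B -/eYB mYB QB.
(* Since [p] is positive, the extended-real inverse is the ordinary one and the conditional mean is
   a real number. *)
have ceE : cond_expectation Q Y B = (m / p)%:E.
  by rewrite /cond_expectation -/eYB mYB QB inver gt_eqF// -EFinM.
(* This is the mean excess of [Y]; were it zero, [Q B] would vanish. Strictness gives [s < m / p],
   needed both for Markov and for cancelling below. *)
have mp0 : 0 < m - s * p.
  rewrite lt0r -lee_fin -EY expectation_ge0 ?andbT; last first.
    by move=> w; rewrite le_max lexx.
  apply: contra_notN (elimN eqP Qn0) => /eqP m0.
  by apply/expectation_excess_eq0; rewrite EY m0.
have sc : s < m / p by rewrite ltr_pdivlMr//; lra.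
(* Markov at the level [m / p]; both sides then carry the positive factor [m / p - s]. *)
have := le_trans (markov_excess X s _ sc) leXY.
rewrite EY (_ : m - s * p = (m / p - s) * p); last first.
  by rewrite mulrBl divfK// gt_eqF.
rewrite EFinM -QB lee_pmul2l//; last by rewrite lte_fin subr_gt0.
by rewrite ceE.
Qed.
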